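(* Every body of constant width in $\mathbb{H}^d$ is strictly convex.
   Context: $\mathbb{H}^d$ is the $d$-dimensional hyperbolic space, and $|ab|$ is the hyperbolic distance of points $a,b$. A set is convex if with every two points it contains the geodesic segment joining them. A convex body in $\mathbb{H}^d$ is a closed bounded convex set with non-empty interior. A hyperplane $H$ supports a convex body $C$ if $H$ has a common point with $C$ and $H$ is disjoint from the interior of $C$. A convex body is strictly convex if every hyperplane supporting it meets it in exactly one point. For non-empty sets $A,B$, $\mathrm{dist}(A,B)$ is the infimum of $|ab|$ over $a\in A$, $b\in B$. Two hyperplanes are ultraparallel if they do not intersect in a real or imaginary point (that is, they meet neither in $\mathbb{H}^d$ nor at infinity). For a hyperplane $H$ supporting a convex body $C$, the width $\mathrm{width}_H(C)$ of $C$ determined by $H$ is the distance $\mathrm{dist}(H,J)$ between $H$ and any farthest (from $H$) hyperplane $J$ among those ultraparallel to $H$ and supporting $C$. A convex body $W\subset\mathbb{H}^d$ is a body of constant width if there is a $\delta$ such that $\mathrm{width}_H(W)=\delta$ for every hyperplane $H$ supporting $W$. *)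

(* Defs.v *)
From HB Require Import structures.
From mathcomp Require Import all_boot all_order all_algebra.
From mathcomp Require Import boolp classical_sets reals topology exp.
From mathcomp Require Import ring lra.

Set Implicit Arguments.
Unset Strict Implicit.
Unset Printing Implicit Defensive.

Import Order.TTheory GRing.Theory Num.Theory.

Local Open Scope classical_set_scope.
Local Open Scope ring_scope.

(** Hyperboloid model of hyperbolic [d]-space: coordinate [ord0] of
    ['rV[R]_d.+1] is the time coordinate. *)

Section LorentzForm.
Context {R : realType} {d : nat}.
Implicit Types x y : 'rV[R]_d.+1.

Definition lorentz x y : R :=
  \sum_(i < d) x ord0 (lift ord0 i) * y ord0 (lift ord0 i)
  - x ord0 ord0 * y ord0 ord0.

Definition on_hyperboloid : pred 'rV[R]_d.+1 :=
  fun x => (lorentz x x == -1) && (0 < x ord0 ord0).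

End LorentzForm.

Record hyperbolic (R : realType) (d : nat) := Hyperbolic {
  hcoord :> 'rV[R]_d.+1 ;
  hcoordP : on_hyperboloid hcoord }.

HB.instance Definition _ (R : realType) (d : nat) :=
  [isSub for @hcoord R d].
HB.instance Definition _ (R : realType) (d : nat) :=
  [Choice of hyperbolic R d by <:].

Definition arcosh {R : realType} (t : R) : R := ln (t + Num.sqrt (t ^+ 2 - 1)).

Definition hdist {R : realType} {d : nat} (a b : hyperbolic R d) : R :=
  arcosh (- lorentz a b).

Section HyperbolicMetric.
Context {R : realType} {d : nat}.
Implicit Types (x y z : 'rV[R]_d.+1) (a b c : hyperbolic R d).

Lemma lorentzC x y : lorentz x y = lorentz y x.
Proof.
rewrite /lorentz [x _ _ * y _ _]mulrC; congr (_ - _).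
by apply: eq_bigr => i _; rewrite mulrC.
Qed.

Lemma lorentzDZl k x y z : lorentz (k *: x + y) z = k * lorentz x z + lorentz y z.
Proof.
rewrite /lorentz !mxE mulrBr mulr_sumr.
under eq_bigr do rewrite !mxE mulrDl -mulrA.
by rewrite big_split /=; ring.
Qed.

Lemma lorentzDZr k x y z : lorentz z (k *: x + y) = k * lorentz z x + lorentz z y.
Proof. by rewrite lorentzC lorentzDZl !(lorentzC z). Qed.

Lemma hyperboloid_lorentz a : lorentz a a = -1.
Proof. by case: a => x /= /andP[/eqP]. Qed.

Lemma hyperboloid_time_gt0 a : 0 < (a : 'rV[R]_d.+1) ord0 ord0.
Proof. by case: a => x /= /andP[]. Qed.

Lemma discriminant_le (p q r : R) : 0 <= p ->
  (forall t, 0 <= p * t ^+ 2 + 2 * q * t + r) -> q ^+ 2 <= p * r.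
Proof.
rewrite le_eqVlt => /predU1P[<-|p0] H.
  rewrite mul0r; have [->|q0] := eqVneq q 0; first by rewrite expr0n.
  have := H (- (r + 1) / (2 * q)).
  by rewrite mul0r add0r mulrC divfK ?mulf_neq0 ?pnatr_eq0 //; lra.
have := H (- q / p); have pn : p != 0 by rewrite gt_eqF.
have -> : p * (- q / p) ^+ 2 + 2 * q * (- q / p) + r = (p * r - q ^+ 2) / p.
  by field.
by rewrite pmulr_lge0 ?invr_gt0 // subr_ge0.
Qed.

Lemma sum_cauchy_schwarz n (f g : 'I_n -> R) :
  (\sum_i f i * g i) ^+ 2 <= (\sum_i f i * f i) * (\sum_i g i * g i).
Proof.
apply: discriminant_le => [|t]; first by apply: sumr_ge0 => i _; exact: sqr_ge0.
have -> : (\sum_i f i * f i) * t ^+ 2 + 2 * (\sum_i f i * g i) * t +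
    \sum_i g i * g i = \sum_i (t * f i + g i) ^+ 2.
  rewrite mulr_suml mulr_sumr mulr_suml -!big_split /=.
  by apply: eq_bigr => i _; ring.
by apply: sumr_ge0 => i _; exact: sqr_ge0.
Qed.

Lemma lorentz_orthogonal x a : lorentz x a = 0 ->
  \sum_(i < d) x ord0 (lift ord0 i) * x ord0 (lift ord0 i) <=
  lorentz x x * (a : 'rV[R]_d.+1) ord0 ord0 ^+ 2.
Proof.
move=> xa; have aa := hyperboloid_lorentz a.
have := sum_cauchy_schwarz (fun i => x ord0 (lift ord0 i))
  (fun i => (a : 'rV[R]_d.+1) ord0 (lift ord0 i)).
move: xa aa; rewrite /lorentz => /subr0_eq -> /(canRL (subrK _)) ->.
by move=> H; nra.
Qed.

Lemma lorentz_orthogonal_ge0 x a : lorentz x a = 0 -> 0 <= lorentz x x.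
Proof.
move=> /lorentz_orthogonal H.
rewrite -(@pmulr_lge0 _ ((a : 'rV[R]_d.+1) ord0 ord0 ^+ 2)); last first.
  by rewrite exprn_gt0 ?hyperboloid_time_gt0.
by apply: le_trans H; apply: sumr_ge0 => i _; exact: sqr_ge0.
Qed.

Lemma lorentz_orthogonal_eq0 x a : lorentz x a = 0 -> lorentz x x = 0 -> x = 0.
Proof.
move=> /lorentz_orthogonal H xx; move: H; rewrite xx mul0r => S0.
have S1 : \sum_(i < d) x ord0 (lift ord0 i) * x ord0 (lift ord0 i) = 0.
  apply/eqP; rewrite eq_le S0 /=.
  by apply: sumr_ge0 => i _; exact: sqr_ge0.
apply/rowP => j; rewrite mxE; case: (unliftP ord0 j) => [i ->|->].
  move: S1 => /psumr_eq0P /(_ _) H.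
  have /eqP := H (fun i _ => sqr_ge0 _) i isT.
  by rewrite mulf_eq0 orbb => /eqP.
move: xx; rewrite /lorentz S1 sub0r => /eqP.
by rewrite oppr_eq0 mulf_eq0 orbb => /eqP.
Qed.

Lemma lorentz_orthogonal_cs x y a : lorentz x a = 0 -> lorentz y a = 0 ->
  lorentz x y ^+ 2 <= lorentz x x * lorentz y y.
Proof.
move=> xa ya; apply: discriminant_le; first exact: lorentz_orthogonal_ge0 xa.
move=> t; have : lorentz (t *: x + y) a = 0 by rewrite lorentzDZl xa ya; ring.
move=> /lorentz_orthogonal_ge0; rewrite lorentzDZl !lorentzDZr (lorentzC y x).
by move=> /le_trans; apply; rewrite le_eqVlt; apply/orP; left; apply/eqP; ring.
Qed.

Lemma lorentz_le a b : 1 <= - lorentz a b.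
Proof.
have := hyperboloid_lorentz a; have := hyperboloid_lorentz b.
have := hyperboloid_time_gt0 a; have := hyperboloid_time_gt0 b.
have := sum_cauchy_schwarz
  (fun i => (a : 'rV[R]_d.+1) ord0 (lift ord0 i))
  (fun i => (b : 'rV[R]_d.+1) ord0 (lift ord0 i)).
rewrite /lorentz; set S := \sum_i _; set A := \sum_i _; set B := \sum_i _.
have A0 : 0 <= A by apply: sumr_ge0 => i _; exact: sqr_ge0.
have B0 : 0 <= B by apply: sumr_ge0 => i _; exact: sqr_ge0.
rewrite -/S -/A -/B.
move: ((a : 'rV[R]_d.+1) ord0 ord0) ((b : 'rV[R]_d.+1) ord0 ord0) => p q.
move=> CS q0 p0 BB AA.
have p1 : 1 <= p by nra.
have q1 : 1 <= q by nra.
have pq : 0 <= p * q - 1 by nra.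
suff : S <= p * q - 1 by lra.
apply: le_trans (ler_norm S) _.
rewrite -(ger0_norm pq) -ler_sqr ?nnegrE ?normr_ge0 // !real_normK ?num_real //.
apply: le_trans CS _.
have -> : A = p * p - 1 by lra.
have -> : B = q * q - 1 by lra.
by have := sqr_ge0 (p - q); nra.
Qed.

Lemma arcosh1 : arcosh (1 : R) = 0.
Proof. by rewrite /arcosh expr1n subrr sqrtr0 addr0 ln1. Qed.

Lemma arcosh_arg_mono (s t : R) : 1 <= s -> s <= t ->
  s + Num.sqrt (s ^+ 2 - 1) <= t + Num.sqrt (t ^+ 2 - 1).
Proof. by move=> s1 st; apply: lerD => //; apply: ler_wsqrtr; nra. Qed.

Lemma arcosh_le (s t : R) : 1 <= s -> s <= t -> arcosh s <= arcosh t.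
Proof.
move=> s1 st; rewrite /arcosh ler_ln ?posrE ?arcosh_arg_mono //.
  by apply: ltr_wpDr; [exact: sqrtr_ge0 | lra].
by apply: ltr_wpDr; [exact: sqrtr_ge0 | lra].
Qed.

Lemma arcosh_eq0 (t : R) : 1 <= t -> arcosh t = 0 -> t = 1.
Proof.
move=> t1; have s0 := sqrtr_ge0 (t ^+ 2 - 1); rewrite /arcosh -ln1 => /ln_inj.
by rewrite !posrE => /(_ _ _) H; have := H ltac:(lra) ltac:(lra); lra.
Qed.

Lemma arcoshD (p q : R) : 1 <= p -> 1 <= q ->
  arcosh (p * q + Num.sqrt (p ^+ 2 - 1) * Num.sqrt (q ^+ 2 - 1)) =
  arcosh p + arcosh q.
Proof.
move=> p1 q1; rewrite /arcosh.
have sp0 := sqrtr_ge0 (p ^+ 2 - 1); have sq0 := sqrtr_ge0 (q ^+ 2 - 1).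
have p0 : 0 <= p ^+ 2 - 1 by nra.
have q0 : 0 <= q ^+ 2 - 1 by nra.
have := sqr_sqrtr p0; have := sqr_sqrtr q0.
move: sp0 sq0; set u := Num.sqrt (p ^+ 2 - 1); set v := Num.sqrt (q ^+ 2 - 1).
move=> u0 v0 vv uu; rewrite -lnM ?posrE; try lra.
have -> : (p * q + u * v) ^+ 2 - 1 = (p * v + q * u) ^+ 2.
  have pE : p ^+ 2 = u ^+ 2 + 1 by lra.
  have qE : q ^+ 2 = v ^+ 2 + 1 by lra.
  have -> : (p * q + u * v) ^+ 2 - 1 =
    p ^+ 2 * q ^+ 2 + u ^+ 2 * v ^+ 2 - 1 + 2 * p * q * u * v by ring.
  have -> : (p * v + q * u) ^+ 2 =
    p ^+ 2 * v ^+ 2 + q ^+ 2 * u ^+ 2 + 2 * p * q * u * v by ring.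
  by rewrite pE qE; ring.
rewrite sqrtr_sqr ger0_norm; last by nra.
by congr (ln _); ring.
Qed.

Lemma hdistxx a : hdist a a = 0.
Proof. by rewrite /hdist hyperboloid_lorentz opprK arcosh1. Qed.

Lemma hdist_sym a b : hdist a b = hdist b a.
Proof. by rewrite /hdist lorentzC. Qed.

Lemma hdist_positivity a b : hdist a b = 0 -> a = b.
Proof.
move=> /(arcosh_eq0 (lorentz_le a b)) ab; apply/val_inj => /=; apply/eqP.
rewrite eq_sym -subr_eq0 -addrC -scaleN1r; apply/eqP.
have aa := hyperboloid_lorentz a; have bb := hyperboloid_lorentz b.
by apply: (@lorentz_orthogonal_eq0 _ a);
  rewrite !lorentzDZl ?lorentzDZr ?(lorentzC b a) aa ?bb; lra.
Qed.

Lemma hdist_triangle b a c : hdist a c <= hdist a b + hdist b c.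
Proof.
rewrite /hdist -arcoshD ?lorentz_le //; apply: arcosh_le => //.
  exact: lorentz_le.
have p1 := lorentz_le a b; have q1 := lorentz_le b c.
have aa := hyperboloid_lorentz a; have bb := hyperboloid_lorentz b.
have cc := hyperboloid_lorentz c.
have xb : lorentz (lorentz a b *: hcoord b + hcoord a) b = 0.
  by rewrite lorentzDZl bb; ring.
have yb : lorentz (lorentz b c *: hcoord b + hcoord c) b = 0.
  by rewrite lorentzDZl bb (lorentzC c b); ring.
have := lorentz_orthogonal_cs xb yb.
rewrite !lorentzDZl !lorentzDZr aa bb cc (lorentzC b a) (lorentzC c b).
move: p1 q1; set p := lorentz a b; set q := lorentz b c; set r := lorentz a c.
move=> p1 q1 H.
rewrite -lerBlDl -sqrtrM; last by nra.
apply: le_trans (ler_norm _) _; rewrite -sqrtr_sqr; apply: ler_wsqrtr.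
by rewrite !sqrrN; apply: le_trans (le_trans _ H) _;
  rewrite le_eqVlt; apply/orP; left; apply/eqP; ring.
Qed.

End HyperbolicMetric.

HB.instance Definition _ (R : realType) (d : nat) :=
  @isMetric.Build R (hyperbolic R d) (@hdist R d) (@hdistxx R d)
    (@hdist_positivity R d) (@hdist_sym R d) (@hdist_triangle R d).

Section ConvexBodies.
Context {R : realType} {d : nat}.
Local Notation H_d := (hyperbolic R d).
Implicit Types (a b : H_d) (A B C W : set H_d).

(** A geodesic from [a] to [b] is an isometric embedding of [[0, l]]. *)
Definition geodesic a b (l : R) (g : R -> H_d) : Prop :=
  [/\ 0 <= l, g 0 = a, g l = b &
      forall s t, 0 <= s <= l -> 0 <= t <= l -> mdist (g s) (g t) = `|s - t|].

Definition geodesic_segment a b : set H_d :=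
  [set z | exists l g, geodesic a b l g /\ exists2 t, 0 <= t <= l & g t = z].

Definition hconvex C : Prop :=
  forall a b, C a -> C b -> geodesic_segment a b `<=` C.

Definition hbounded C : Prop :=
  exists M : R, forall a b, C a -> C b -> mdist a b <= M.

Definition convex_body C : Prop :=
  [/\ closed C, hbounded C, hconvex C & interior C !=set0].

(** A hyperplane is the trace on the hyperboloid of the Lorentz-orthogonal
    complement of a spacelike vector. *)
Record hyperplane := Hyperplane {
  normal : 'rV[R]_d.+1 ;
  normal_spacelike : 0 < lorentz normal normal }.

Definition hyperplane_set (H : hyperplane) : set H_d :=
  [set x | lorentz x (normal H) = 0].

Local Coercion hyperplane_set : hyperplane >-> set.

(** Nonzero null vectors, up to scaling, are the points at infinity. *)
Definition points_at_infinity (H : hyperplane) : set 'rV[R]_d.+1 :=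
  [set x | [/\ x != 0, lorentz x x = 0 & lorentz x (normal H) = 0]].

Definition ultraparallel (H J : hyperplane) : Prop :=
  H `&` J = set0 /\ points_at_infinity H `&` points_at_infinity J = set0.

Definition supports (H : hyperplane) C : Prop :=
  H `&` C !=set0 /\ H `&` interior C = set0.

Definition strictly_convex C : Prop :=
  forall H : hyperplane, supports H C -> exists x, H `&` C = [set x].

Definition set_dist A B : R := inf [set mdist a b | a in A & b in B].

Definition ultraparallel_support (H : hyperplane) C (J : hyperplane) : Prop :=
  ultraparallel H J /\ supports J C.

(** [is_width H C w]: some farthest [J] exists and [w = dist(H, J)]. *)
Definition is_width (H : hyperplane) C (w : R) : Prop :=
  exists J : hyperplane,
    [/\ ultraparallel_support H C J,
        forall J' : hyperplane,
          ultraparallel_support H C J' -> set_dist H J' <= set_dist H J &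
        w = set_dist H J].

Definition body_of_constant_width W : Prop :=
  convex_body W /\
  exists delta : R, forall H : hyperplane, supports H W -> is_width H W delta.

End ConvexBodies.

(* Main.v *)
Require Import Defs.
From mathcomp Require Import all_boot all_order all_algebra.
From mathcomp Require Import boolp classical_sets reals topology exp.
From mathcomp Require Import normedtype sequences derive ring lra.

Set Implicit Arguments.
Unset Strict Implicit.
Unset Printing Implicit Defensive.

Import Order.TTheory GRing.Theory Num.Theory.
Import numFieldNormedType.Exports.

Local Open Scope classical_set_scope.
Local Open Scope ring_scope.

(** For a unit spacelike vector [v], call [lorentz x v] the height of the point
    [x] over the hyperplane orthogonal to [v]: it is the hyperbolic sine of the
    signed distance, so the distance itself is [arcosh (sqrt (1 + height^2))].

    Let [H] support a body [W] of constant width [delta], let [J] be a farthest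
    ultraparallel supporting hyperplane, so that [delta = dist(H, J)], and let
    [v] be the unit normal of [J].

    The width of [W] determined by [J] bounds the distance from [J] of every
    point of [W] ([width_ge_pointwise]).  Indeed [W] is compact, so some point
    [q] of [W] has maximal height over [J] in absolute value.  The hyperplane
    [K] through [q] that is perpendicular to the perpendicular from [q] to [J]
    supports [W] and is ultraparallel to [J], and [dist(J, K)] is the distance
    of [q] from [J] ([tangent_support]).  As [J] supports [W] too, its width is
    again [delta]: every point of [W] is within [delta] of [J].

    Suppose that [H] meets [W] in two points [a], [b].  Both are within [delta]
    of [J], and neither is on [J], which is disjoint from [H].  Their midpoint
    [m] lies on [H] and is strictly closer to [J] than the farther of [a] and
    [b] ([midpoint_exists]), hence closer than [delta = dist(H, J)], which is
    absurd. *)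

(** * Algebra of the Lorentz form *)

Section LorentzAlgebra.
Context {R : realType} {d : nat}.
Implicit Types (x y z v : 'rV[R]_d.+1) (a b p : hyperbolic R d) (k : R).

Lemma lorentzDl x y z : lorentz (x + y) z = lorentz x z + lorentz y z.
Proof. by rewrite -[x]scale1r lorentzDZl mul1r scale1r. Qed.

Lemma lorentz0l z : lorentz 0 z = 0.
Proof.
by have := lorentzDl 0 0 z; rewrite addr0 => /eqP; rewrite addrC -subr_eq subrr => /eqP.
Qed.

Lemma lorentzZl k x z : lorentz (k *: x) z = k * lorentz x z.
Proof. by rewrite -[k *: x]addr0 lorentzDZl lorentz0l addr0. Qed.

Lemma lorentzNl x z : lorentz (- x) z = - lorentz x z.
Proof. by rewrite -scaleN1r lorentzZl mulN1r. Qed.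

Lemma lorentzDr x y z : lorentz z (x + y) = lorentz z x + lorentz z y.
Proof. by rewrite lorentzC lorentzDl !(lorentzC z). Qed.

Lemma lorentzZr k x z : lorentz z (k *: x) = k * lorentz z x.
Proof. by rewrite lorentzC lorentzZl (lorentzC z). Qed.

Lemma lorentzNr x z : lorentz z (- x) = - lorentz z x.
Proof. by rewrite lorentzC lorentzNl (lorentzC z). Qed.

Definition lorentzE :=
  (lorentzDl, lorentzDr, lorentzNl, lorentzNr, lorentzZl, lorentzZr).

(** The condition [lorentz y a < 0] selects the sheet: two timelike vectors
    have negative Lorentz product exactly when they lie in the same cone. *)
Lemma timelike_normalize y a : lorentz y y < 0 -> lorentz y a < 0 ->
  exists h : hyperbolic R d, hcoord h = (Num.sqrt (- lorentz y y))^-1 *: y.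
Proof.
move=> yy ya; set r := Num.sqrt _.
have r0 : 0 < r by rewrite sqrtr_gt0; lra.
have rr : r ^+ 2 = - lorentz y y by rewrite sqr_sqrtr //; lra.
have unit_norm z : lorentz z z = lorentz y y -> lorentz (r^-1 *: z) (r^-1 *: z) = -1.
  move=> zz; rewrite !lorentzE zz -[lorentz y y]opprK -rr; field.
  by rewrite gt_eqF.
have ri0 : 0 < r^-1 by rewrite invr_gt0.
have [y0|y0|y0] := ltrgtP 0 (y ord0 ord0).
- have hP : on_hyperboloid (r^-1 *: y).
    by rewrite /on_hyperboloid unit_norm // eqxx mxE mulr_gt0.
  by exists (Hyperbolic hP).
(* On the past cone, [- y] would normalize to a point contradicting [lorentz_le]. *)
- have hP : on_hyperboloid (r^-1 *: - y).
    by rewrite /on_hyperboloid unit_norm ?lorentzE ?opprK // eqxx !mxE mulr_gt0 ?oppr_gt0.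
  have := lorentz_le (Hyperbolic hP) a; rewrite /= lorentzE lorentzNl.
  have : 0 < r^-1 * - lorentz y a by rewrite mulr_gt0 ?oppr_gt0.
  lra.
- move: yy; rewrite /lorentz -y0 mulr0 subr0 ltNge sumr_ge0 // => i _.
  exact: sqr_ge0.
Qed.

(** [f] is the foot of the perpendicular from [p] to the hyperplane orthogonal
    to [v].  The factorization is the hyperbolic Pythagorean theorem
    [cosh |zp| = cosh |pf| * cosh |zf|] for [z] on the hyperplane; stated for all
    vectors [z], it comes from [p] being a combination of [f] and [v]. *)
Lemma foot_exists v p : lorentz v v = 1 ->
  exists f : hyperbolic R d, lorentz f v = 0 /\
    forall z, lorentz z v = 0 ->
      lorentz z p = Num.sqrt (1 + lorentz p v ^+ 2) * lorentz z f.
Proof.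
move=> vv; set t := lorentz p v; set r := Num.sqrt _.
have [y yE] : exists y, y = hcoord p - t *: v by eexists.
have pp := hyperboloid_lorentz p.
have t2 := sqr_ge0 t.
have yp : lorentz y p = - (1 + t ^+ 2).
  by rewrite yE !lorentzE pp (lorentzC v p) -/t; ring.
have yv : lorentz y v = 0 by rewrite yE !lorentzE vv -/t; ring.
have yy : lorentz y y = - (1 + t ^+ 2).
  by rewrite {2}yE !lorentzE yp yv; ring.
have yy0 : lorentz y y < 0 by rewrite yy; lra.
have yp0 : lorentz y p < 0 by rewrite yp; lra.
have [f] := timelike_normalize yy0 yp0.
rewrite yy opprK -/r => fE; exists f; rewrite fE; split.
  by rewrite lorentzZl yv mulr0.
have r0 : r != 0 by rewrite gt_eqF // sqrtr_gt0; lra.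
by move=> z zv; rewrite lorentzZr mulVKf // yE !lorentzE zv; ring.
Qed.

(** The scalar is [1 / |a + b|], where [|a + b|^2 = 2 + 2 cosh |ab| > 4].  As
    [c < 1/2], a nonzero height of [m] over a hyperplane is smaller in absolute
    value than the larger of the heights of [a] and [b]. *)
Lemma midpoint_exists a b : a <> b -> exists (m : hyperbolic R d) c,
  0 < c < 2^-1 /\ hcoord m = c *: (hcoord a + hcoord b).
Proof.
move=> ab; have l1 := lorentz_le a b.
have l2 : 1 < - lorentz a b.
  rewrite lt_neqAle l1 andbT; apply/eqP => l; apply/ab/hdist_positivity.
  by rewrite /hdist -l arcosh1.
have aa := hyperboloid_lorentz a; have bb := hyperboloid_lorentz b.
pose y := hcoord a + hcoord b.
have yy : lorentz y y = - (2 - 2 * lorentz a b).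
  by rewrite !lorentzE aa bb (lorentzC b a); ring.
have ya : lorentz y a < 0 by rewrite !lorentzE aa (lorentzC b a); lra.
have [|m mE] := timelike_normalize _ ya; first by rewrite yy; lra.
exists m, (Num.sqrt (- lorentz y y))^-1; split=> //.
have r2 : 2 < Num.sqrt (- lorentz y y).
  rewrite -[2]ger0_norm // -sqrtr_sqr ltr_sqrt yy; lra.
by rewrite invr_gt0 ltf_pV2 ?posrE; lra.
Qed.

End LorentzAlgebra.

(** * Inverse hyperbolic cosine *)

Section Arcosh.
Context {R : realType}.
Implicit Types s t e : R.

Lemma sqrt1Dsqr_ge1 t : 1 <= Num.sqrt (1 + t ^+ 2).
Proof. by rewrite -[leLHS]sqrtr1 ler_wsqrtr // lerDl sqr_ge0. Qed.

Lemma arcosh_lt s t : 1 <= s -> s < t -> arcosh s < arcosh t.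
Proof.
move=> s1 st; have s0 := sqrtr_ge0 (s ^+ 2 - 1); have t0 := sqrtr_ge0 (t ^+ 2 - 1).
rewrite /arcosh ltr_ln ?posrE; try lra.
by apply: ltr_leD => //; apply: ler_wsqrtr; nra.
Qed.

Lemma le_expR_arcosh t : 1 <= t -> t <= expR (arcosh t).
Proof.
move=> t1; have t0 := sqrtr_ge0 (t ^+ 2 - 1).
by rewrite /arcosh lnK ?posrE; lra.
Qed.

Lemma arcosh_near1 e : 0 < e ->
  exists2 h, 0 < h & forall t, 1 <= t -> t < 1 + h -> arcosh t < e.
Proof.
move=> e0.
have E1 : 1 < expR e by rewrite expR_gt1.
have F0 : 0 < expR (- e) by exact: expR_gt0.
have EF : expR e * expR (- e) = 1 by rewrite -expRD subrr expR0.
have F1 : expR (- e) < 1 by rewrite expR_lt1; lra.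
(* [c] is [cosh e]. *)
pose c := (expR e + expR (- e)) / 2.
have c1 : 1 < c by rewrite /c; nra.
have cE : arcosh c = e.
  rewrite /arcosh (_ : c ^+ 2 - 1 = ((expR e - expR (- e)) / 2) ^+ 2).
    rewrite sqrtr_sqr ger0_norm; last by lra.
    by rewrite (_ : _ + _ = expR e) ?expRK // /c; field.
  transitivity (c ^+ 2 - expR e * expR (- e)); first by rewrite EF.
  by rewrite /c; field.
exists (c - 1); first lra.
by move=> t t1 tc; rewrite -cE; apply: arcosh_lt => //; lra.
Qed.

End Arcosh.

(** * Topology of hyperbolic space *)

Section MetricFacts.
Context {R : realType} {d : nat}.
Implicit Types (A B W : set (hyperbolic R d)) (a b p : hyperbolic R d).

Lemma set_dist_le_mdist A B a b : A a -> B b -> set_dist A B <= mdist a b.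
Proof.
move=> Aa Bb; apply: ge_inf; last by exists a => //; exists b.
by exists 0 => _ [x _ [y _ <-]]; exact: mdist_ge0.
Qed.

Lemma le_set_dist A B c : A !=set0 -> B !=set0 ->
  (forall a b, A a -> B b -> c <= mdist a b) -> c <= set_dist A B.
Proof.
move=> [a Aa] [b Bb] cAB; apply: lb_le_inf.
  by exists (mdist a b), a => //; exists b.
by move=> _ [x Ax [y By <-]]; exact: cAB.
Qed.

Lemma closed_hdist W a : closed W ->
  (forall e, 0 < e -> exists2 w, W w & hdist a w < e) -> W a.
Proof.
move=> Wcl aW; apply: Wcl => B /nbhs_ballP[e /= e0 eB].
have [w Ww aw] := aW e e0; exists w; split=> //; apply: eB.
by rewrite ballEmdist.
Qed.

Lemma interior_hdist W a : interior W a ->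
  exists2 e, 0 < e & forall b, hdist a b < e -> W b.
Proof.
move=> /nbhs_ballP[e /= e0 eW]; exists e => // b ab; apply: eW.
Qed.

(** From a point [a] of the boundary hyperplane, the points [T a + q k] with
    [T^2 - q^2 lorentz k k = 1] move along the perpendicular geodesic out of the
    half-space, and are near [a] when [T] is near [1]. *)
Lemma interior_of_halfspace_subset W (k : 'rV[R]_d.+1) a : 0 < lorentz k k ->
  (forall x, W x -> lorentz x k <= 0) -> interior W a -> lorentz a k != 0.
Proof.
move=> kk Wk /interior_hdist[e e0 eW]; apply/eqP => ak.
have [h h0 hP] := arcosh_near1 e0.
pose T := 1 + h / 2; pose q := Num.sqrt ((T ^+ 2 - 1) / lorentz k k).
have T1 : 1 < T by rewrite /T; lra.
have q2 : q ^+ 2 * lorentz k k = T ^+ 2 - 1.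
  rewrite sqr_sqrtr ?divfK ?gt_eqF // divr_ge0 ?ltW //; nra.
have q0 : 0 < q by rewrite sqrtr_gt0 divr_gt0 //; nra.
pose y := T *: hcoord a + q *: k.
have aa := hyperboloid_lorentz a.
have yy : lorentz y y = -1.
  by rewrite !lorentzE aa (lorentzC k a) ak; lra.
have ya : lorentz y a = - T by rewrite !lorentzE aa (lorentzC k a) ak; ring.
have [||x] := @timelike_normalize _ _ y a; [lra|lra|].
rewrite yy opprK sqrtr1 invr1 scale1r => xE.
have /Wk : W x.
  by apply: eW; apply: hP; rewrite lorentzC xE ya opprK /T; lra.
have := mulr_gt0 q0 kk; rewrite xE !lorentzE ak; lra.
Qed.

Lemma continuous_lorentz (T : topologicalType) (f g : T -> 'rV[R]_d.+1) :
  continuous f -> continuous g -> continuous (fun x => lorentz (f x) (g x)).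
Proof.
move=> cf cg.
have cc i j : continuous (fun x => f x i j * g x i j).
  move=> x; apply: cvgM.
    exact: (cvg_comp f (fun M : 'rV[R]_d.+1 => M i j) (cf x) (@coord_continuous _ _ _ i j _)).
  exact: (cvg_comp g (fun M : 'rV[R]_d.+1 => M i j) (cg x) (@coord_continuous _ _ _ i j _)).
move=> x; apply: cvgB; last exact: cc.
by apply: cvg_big => [|i _]; [exact: add_continuous | exact: cc].
Qed.

Lemma hyperbolic_origin : exists o : hyperbolic R d,
  forall x : 'rV[R]_d.+1, lorentz o x = - x ord0 ord0.
Proof.
pose e : 'rV[R]_d.+1 := delta_mx ord0 ord0.
have eE x : lorentz e x = - x ord0 ord0.
  rewrite /lorentz big1 ?mxE ?eqxx ?mul1r ?sub0r // => i _.
  by rewrite mxE mul0r.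
have eP : on_hyperboloid e by rewrite /on_hyperboloid eE !mxE !eqxx ltr01.
by exists (Hyperbolic eP).
Qed.

Lemma hcoord_le_time p i : `|(p : 'rV[R]_d.+1) ord0 i| <= (p : 'rV[R]_d.+1) ord0 ord0.
Proof.
have p0 := hyperboloid_time_gt0 p; have [j ->|->] := unliftP ord0 i; last first.
  by rewrite gtr0_norm.
rewrite -(ger0_norm (ltW p0)) -ler_sqr ?nnegrE // !real_normK ?num_real //.
have := hyperboloid_lorentz p; rewrite /lorentz (bigD1 j) //=.
set s := \sum_(_ < _ | _) _ => pp.
have : 0 <= s by apply: sumr_ge0 => k _; exact: sqr_ge0.
lra.
Qed.

(** Heine-Borel, through the compact boxes of the ambient space.  Boundedness
    carries over because the time coordinate of [x] is the hyperbolic cosine of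
    its distance from the origin and dominates the other coordinates.  A limit
    [x] of points [w] of [W] stays on the hyperboloid, and [- lorentz x w] tends
    to [1], so [w] tends to [x] in the hyperbolic metric. *)
Lemma compact_hcoord W : closed W -> hbounded W -> compact (@hcoord R d @` W).
Proof.
move=> Wcl [M WM].
have [->|/set0P[a Wa]] := eqVneq W set0; first by rewrite image_set0; exact: compact0.
have [o oE] := hyperbolic_origin.
pose E := expR (hdist o a + M).
have XE : @hcoord R d @` W `<=`
    [set x : 'rV[R]_d.+1 | forall i, `[- E, E]%classic (x ord0 i)].
  move=> _ [x Wx <-] i /=; rewrite in_itv /= -ler_norml.
  apply: le_trans (hcoord_le_time x i) _.
  have ox : 1 <= (x : 'rV[R]_d.+1) ord0 ord0.
    by have := lorentz_le o x; rewrite oE opprK.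
  apply: le_trans (le_expR_arcosh ox) _; rewrite ler_expR.
  rewrite -[X in arcosh X]opprK -oE.
  apply: le_trans (hdist_triangle a o x) _; rewrite lerD2l.
  exact: WM.
apply: subclosed_compact XE; last first.
  by apply: (@rV_compact R d.+1 (fun=> `[- E, E]%classic)) => i; exact: segment_compact.
have clX (f : 'rV[R]_d.+1 -> R) (C : set R) : continuous f -> closed C ->
    (forall w, W w -> C (f w)) -> forall x, closure (@hcoord R d @` W) x -> C (f x).
  move=> cf Ccl WC x Xx.
  have := preimage_closed (fun y _ => cf y) Ccl.
  move=> /closure_id => fC; have : (f @^-1` C) x; last by [].
  rewrite fC; apply: closureS Xx => _ [w Ww <-]; exact: WC.
have cid : continuous (fun x : 'rV[R]_d.+1 => x) by move=> ?; exact: cvg_id.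
move=> x Xx.
have xx : lorentz x x = -1.
  apply: (clX _ [set y : R | y = -1] (continuous_lorentz cid cid) (@closed_eq R (-1))) => //.
  by move=> w _ /=; exact: hyperboloid_lorentz.
have x0 : 0 <= x ord0 ord0.
  apply: (clX _ [set y : R | 0 <= y] (@coord_continuous R 1 d.+1 ord0 ord0) (@closed_ge R 0)) => //.
  by move=> w _ /=; exact/ltW/hyperboloid_time_gt0.
have xP : on_hyperboloid x.
  rewrite /on_hyperboloid xx eqxx /= lt0r x0 andbT; apply/eqP => x00.
  move: xx; rewrite /lorentz x00 mulr0 subr0 => xx.
  have : 0 <= \sum_(i < d) x ord0 (lift ord0 i) * x ord0 (lift ord0 i).
    by apply: sumr_ge0 => i _; exact: sqr_ge0.
  rewrite xx; lra.
exists (Hyperbolic xP) => //; apply: closed_hdist => // e e0.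
have [h h0 hP] := arcosh_near1 e0.
have cst : continuous (fun _ : 'rV[R]_d.+1 => x) by exact: cst_continuous.
have : nbhs (lorentz x x) `]-1 - h, -1 + h[%classic.
  by rewrite xx; apply: near_in_itvoo; rewrite in_itv /=; lra.
move=> /(continuous_lorentz cst cid).
move=> /Xx [_ [[w Ww <-]]] /=; rewrite in_itv /= => /andP[l1 l2].
by exists w => //; apply: hP; [exact: lorentz_le | rewrite /=; lra].
Qed.

Lemma lorentz_max_exists W v : closed W -> hbounded W -> W !=set0 ->
  exists2 p, W p & forall x, W x -> `|lorentz x v| <= `|lorentz p v|.
Proof.
move=> Wcl Wb [a Wa].
have cf : continuous (fun x : 'rV[R]_d.+1 => `|lorentz x v|).
  have cl : continuous (fun x : 'rV[R]_d.+1 => lorentz x v).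
    by apply: continuous_lorentz; [move=> ?; exact: cvg_id | exact: cst_continuous].
  by move=> x; exact: (continuous_comp (cl x) (@norm_continuous _ R^o _)).
have [|_ /set_mem[p Wp <-] pmax] := EVT_max_rV _ (compact_hcoord Wcl Wb) (continuous_subspaceT cf).
  by exists a, a.
exists p => // x Wx; apply: pmax; rewrite inE; by exists x.
Qed.

End MetricFacts.

(** * Distances to a hyperplane and the width *)

Section Hyperplanes.
Context {R : realType} {d : nat}.
Implicit Types (W : set (hyperbolic R d)) (p : hyperbolic R d).
Implicit Types (H J K : @hyperplane R d) (v : 'rV[R]_d.+1).

Lemma unit_normal_exists J : exists c v,
  [/\ c != 0, lorentz v v = 1 & normal J = c *: v].
Proof.
have n0 := normal_spacelike J; pose c := Num.sqrt (lorentz (normal J) (normal J)).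
have c0 : c != 0 by rewrite gt_eqF // sqrtr_gt0.
exists c, (c^-1 *: normal J); split=> //; last by rewrite scalerA mulfV ?scale1r.
by rewrite !lorentzE -[lorentz _ _](sqr_sqrtr (ltW n0)) -/c; field.
Qed.

Lemma hyperplane_setE J c v : c != 0 -> normal J = c *: v ->
  forall x, hyperplane_set J x <-> lorentz x v = 0.
Proof.
move=> c0 JE x; rewrite /hyperplane_set /= JE lorentzZr.
by split=> [/eqP|->]; rewrite ?mulr0 // mulf_eq0 (negPf c0) => /eqP.
Qed.

Lemma hyperplane_foot J c v p : c != 0 -> lorentz v v = 1 ->
  normal J = c *: v -> exists2 f, hyperplane_set J f &
    hdist p f = arcosh (Num.sqrt (1 + lorentz p v ^+ 2)).
Proof.
move=> c0 vv JE; have [f [fv fE]] := foot_exists p vv; exists f.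
  exact/(hyperplane_setE c0 JE).
by rewrite /hdist lorentzC fE // hyperboloid_lorentz mulrN1 opprK.
Qed.

Lemma hdist_ge_height v p (z : hyperbolic R d) : lorentz v v = 1 -> lorentz z v = 0 ->
  arcosh (Num.sqrt (1 + lorentz p v ^+ 2)) <= hdist z p.
Proof.
move=> vv zv; have [f [fv fE]] := foot_exists p vv.
have r1 := sqrt1Dsqr_ge1 (lorentz p v).
by apply: arcosh_le => //; rewrite fE //; have := lorentz_le z f; nra.
Qed.

(** [K] is the hyperplane through [p] tangent to the equidistant hypersurface of
    [J] through [p]; its normal [k] spans with [p] the plane of [p] and [v].
    [W] is on one side of [K]: the height of [x] relative to [K] is a positive
    multiple of [lorentz x v + s * lorentz x p], where [lorentz x v <= s] and
    [lorentz x p <= -1].  Points of [K] have height at least [s] over [J] for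
    the same reason, which bounds [dist(J, K)] from below. *)
Lemma tangent_support W J c v p : c != 0 -> lorentz v v = 1 ->
    normal J = c *: v -> W p -> 0 < lorentz p v ->
    (forall x, W x -> lorentz x v <= lorentz p v) ->
  exists2 K, ultraparallel_support J W K &
    arcosh (Num.sqrt (1 + lorentz p v ^+ 2)) <=
      set_dist (hyperplane_set J) (hyperplane_set K).
Proof.
move=> c0 vv JE Wp; set s := lorentz p v => s0 Wmax.
have JP := hyperplane_setE c0 JE.
have pp := hyperboloid_lorentz p.
pose k := v + s *: hcoord p.
have kk : 0 < lorentz k k.
  by rewrite !lorentzE vv pp (lorentzC v p) -/s; nra.
have pk : lorentz p k = 0 by rewrite !lorentzE pp -/s; ring.
have xk x : lorentz x k = lorentz x v + s * lorentz x p by rewrite !lorentzE.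
pose K := Hyperplane kk.
have Kv z : hyperplane_set K z -> s <= lorentz z v.
  by rewrite /hyperplane_set /= xk; have := lorentz_le z p; nra.
exists K; last first.
  apply: le_set_dist; last 1 first.
  - move=> y z /JP yv /Kv zv.
    apply: le_trans (hdist_ge_height z vv yv).
    apply: arcosh_le; first exact: sqrt1Dsqr_ge1.
    by apply: ler_wsqrtr; nra.
  - by have [f Jf _] := hyperplane_foot p c0 vv JE; exists f.
  - by exists p.
split; split.
- apply/seteqP; split=> // z [/JP zv /Kv]; rewrite zv; lra.
(* A null vector orthogonal to [v] and [k] is orthogonal to the timelike [p]. *)
- apply/seteqP; split=> // x [[x0 xx]]; rewrite JE lorentzZr => /eqP.
  rewrite mulf_eq0 (negPf c0) /= => /eqP xv [_ _] /=.
  rewrite xk xv add0r => /eqP; rewrite mulf_eq0 gt_eqF //= => /eqP xp.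
  by move/eqP: x0; apply; exact: lorentz_orthogonal_eq0 xp xx.
- by exists p.
- apply/seteqP; split=> // x [Kx Wx].
  have /eqP[] : lorentz x k != 0 by apply: interior_of_halfspace_subset Wx => // y Wy;
    rewrite xk; have := lorentz_le y p; have := Wmax y Wy; nra.
  exact: Kx.
Qed.

(** A point of maximal distance from [J] yields a tangent supporting hyperplane
    that competes with the farthest one.  With [p] off [J] the maximal
    height is positive, so that the tangent hyperplane avoids [J]. *)
Lemma width_ge_pointwise W J w p c v : closed W -> hbounded W -> W p ->
    c != 0 -> lorentz v v = 1 -> normal J = c *: v -> is_width J W w ->
    lorentz p v != 0 ->
  arcosh (Num.sqrt (1 + lorentz p v ^+ 2)) <= w.
Proof.
move=> Wcl Wb Wp c0 vv JE [J' [_ J'max ->]] pv.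
have [|q Wq qmax] := lorentz_max_exists v Wcl Wb; first by exists p.
have le_q x : W x -> lorentz x v ^+ 2 <= lorentz q v ^+ 2.
  by move=> Wx; rewrite -[leLHS]real_normK ?num_real // -[leRHS]real_normK ?num_real //
    ler_sqr ?nnegrE // qmax.
apply: (@le_trans _ _ (arcosh (Num.sqrt (1 + lorentz q v ^+ 2)))).
  apply: arcosh_le; first exact: sqrt1Dsqr_ge1.
  by rewrite ler_wsqrtr // lerD2l le_q.
have q0 : lorentz q v != 0.
  by rewrite -normr_gt0 (lt_le_trans _ (qmax p Wp)) // normr_gt0.
(* [e] is the sign that puts [q] on the positive side of [J]. *)
have [e [e0 eq ee]] : exists e : R, [/\ e != 0, 0 < e * lorentz q v & e ^+ 2 = 1].
  have [qlt|qgt|] := ltrgtP (lorentz q v) 0; last by move=> q00; rewrite q00 eqxx in q0.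
  - by exists (-1); split; [rewrite oppr_eq0 oner_eq0 | lra | ring].
  - by exists 1; split; [exact: oner_neq0 | lra | ring].
have := @tangent_support W J (c * e) (e *: v) q.
rewrite !lorentzE vv mulr1 -expr2 ee => tg.
have [||||||K JK] := tg; rewrite ?mulf_neq0 //.
- by rewrite JE scalerA -mulrA -expr2 ee mulr1.
- move=> x Wx; rewrite lorentzZr; apply: le_trans (ler_norm _) _.
  by rewrite -(gtr0_norm eq) !normrM ler_wpM2l ?qmax.
by rewrite exprMn ee mul1r => /le_trans; apply; exact: J'max.
Qed.

End Hyperplanes.

Theorem proposition3 (R : realType) (d : nat) (W : set (hyperbolic R d)) :
  body_of_constant_width W -> strictly_convex W.
Proof.
move=> [[Wcl Wb _ _] [w Ww]] H HW; have [[a [Ha Wa]] _] := HW.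
exists a; apply/seteqP; split=> [b [Hb Wb']|_ ->] //=; apply: contrapT => ba.
have [J [[[HJ _] JW] _ wE]] := Ww H HW.
have [c [v [c0 vv JE]]] := unit_normal_exists J.
have off_J x : hyperplane_set H x -> lorentz x v != 0.
  move=> Hx; apply/eqP => xv.
  suff : (hyperplane_set H `&` hyperplane_set J) x by rewrite HJ.
  by split=> //; apply/(hyperplane_setE c0 JE).
have [m [t [/andP[t0 t2] mE]]] := midpoint_exists ba.
have Hm : hyperplane_set H m.
  by move: Ha Hb; rewrite /hyperplane_set /= mE !lorentzE => -> ->; rewrite addr0 mulr0.
have m_ge x : W x -> hyperplane_set H x -> lorentz x v ^+ 2 <= lorentz m v ^+ 2.
  move=> Wx Hx; have [f Jf mf] := hyperplane_foot m c0 vv JE.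
  have := width_ge_pointwise Wcl Wb Wx c0 vv JE (Ww J JW) (off_J x Hx).
  rewrite leNgt => le_w; rewrite leNgt; apply: contra le_w => lt_mx.
  apply: (@le_lt_trans _ _ (hdist m f)).
    by rewrite wE; exact: set_dist_le_mdist.
  rewrite mf; apply: arcosh_lt.
    exact: sqrt1Dsqr_ge1.
  rewrite ltr_sqrt ?ltrD2l //; have := sqr_ge0 (lorentz x v); lra.
have := m_ge a Wa Ha; have := m_ge b Wb' Hb; have := off_J m Hm.
rewrite mE !lorentzE; move: (lorentz a v) (lorentz b v) => A B m0 le_b le_a.
(* [A^2 + B^2 <= 2 t^2 (A + B)^2 < (A + B)^2 / 2 <= A^2 + B^2]. *)
have AB0 : 0 < (B + A) ^+ 2.
  by rewrite exprn_even_gt0 //=; apply: contraNneq m0 => ->; rewrite mulr0.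
have tt : t ^+ 2 < 4^-1 by nra.
have := sqr_ge0 (A - B); rewrite exprMn in le_a le_b.
nra.
Qed.
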